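(* Let $R$ be a right $\Sigma$-$V$ ring. Then the following are equivalent: (1) $R$ is right primitive. (2) $R$ is prime. (3) $R$ is left primitive.
   Context: All rings are associative with identity element and modules are unital. A right $R$-module $M$ is called $\Sigma$-injective if the direct sum $M^{(\alpha)}$ of $\alpha$ copies of $M$ is injective for every cardinal $\alpha$. A ring $R$ is called a right $\Sigma$-$V$ ring if each simple right $R$-module is $\Sigma$-injective. A ring is right (resp. left) primitive if it has a faithful simple right (resp. left) module. *)

(* Defs.v *)
From HB Require Import structures.
From mathcomp Require Import all_boot all_algebra.
From mathcomp Require Import boolp classical_sets functions cardinality.

Set Implicit Arguments.
Unset Strict Implicit.
Unset Printing Implicit Defensive.

Import GRing.Theory.

Local Open Scope ring_scope.

(* A right R-module is an lmodType over the converse ring R^c. All module     *)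
(* notions below are stated for lmodType over a ring S and are instantiated   *)
(* with S := R (left modules) or S := R^c (right modules). Rings are          *)
(* pzRingType, so that the zero ring is allowed.                              *)

(* A submodule is a boolean predicate; boolp identifies these with arbitrary  *)
(* subsets.                                                                   *)
Definition simple_module (S : pzRingType) (M : lmodType S) : Prop :=
  (exists x : M, x != 0) /\
  forall N : {pred M}, submod_closed N ->
    (forall x, x \in N -> x = 0) \/ (forall x, x \in N).

Definition faithful_module (S : pzRingType) (M : lmodType S) : Prop :=
  forall a : S, (forall x : M, a *: x = 0) -> a = 0.

Definition injective_module (S : pzRingType) (E : lmodType S) : Prop :=
  forall (A B : lmodType S) (f : {linear A -> B}) (g : {linear A -> E}),
    injective f -> exists h : {linear B -> E}, forall x, h (f x) = g x.

Section CopowerModule.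
Variables (S : pzRingType) (I : Type) (M : lmodType S).

Definition finite_support : {pred I -> M} :=
  fun f => `[< finite_set [set i | f i <> 0]%classic >].

Lemma finite_support_submod_closed : submod_closed finite_support.
Proof.
split=> [|a u v /asboolP fu /asboolP fv]; apply/asboolP.
  by rewrite (_ : [set _ | _]%classic = set0)//; apply/seteqP; split=> i //=.
apply: (@sub_finite_set _ _ ([set i | u i <> 0] `|` [set i | v i <> 0])%classic);
  last by rewrite finite_setU.
move=> i /= uv0; apply: contrapT => /not_orP[/contrapT u0 /contrapT v0].
by apply: uv0; rewrite !fctE u0 v0 scaler0 addr0.
Qed.

HB.instance Definition _ :=
  GRing.isSubmodClosed.Build S (I -> M) finite_support
    finite_support_submod_closed.

(* The direct sum M^(I), as the submodule of M^I of functions with finite     *)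
(* support.                                                                   *)
Record copower := Copower {
  copower_fun :> I -> M ;
  _ : copower_fun \in finite_support }.

HB.instance Definition _ := [isSub for copower_fun].
HB.instance Definition _ := [Choice of copower by <:].
HB.instance Definition _ := [SubChoice_isSubLmodule of copower by <:].

End CopowerModule.

Definition sigma_injective (S : pzRingType) (M : lmodType S) : Prop :=
  forall I : Type, injective_module (copower I M).

Definition right_sigma_V_ring (R : pzRingType) : Prop :=
  forall M : lmodType R^c, simple_module M -> sigma_injective M.

Definition left_primitive (R : pzRingType) : Prop :=
  exists M : lmodType R, simple_module M /\ faithful_module M.

Definition right_primitive (R : pzRingType) : Prop :=
  exists M : lmodType R^c, simple_module M /\ faithful_module M.

Definition two_sided_ideal (R : pzRingType) (I : {pred R}) : Prop :=
  zmod_closed I /\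
  forall a x : R, x \in I -> a * x \in I /\ x * a \in I.

(* The product of the ideals I and J is zero iff all x * y with x in I and    *)
(* y in J vanish, since these elements generate it additively.                *)
Definition prime_ring (R : pzRingType) : Prop :=
  (1 : R) <> 0 /\
  forall I J : {pred R}, two_sided_ideal I -> two_sided_ideal J ->
    (forall x y, x \in I -> y \in J -> x * y = 0) ->
    (forall x, x \in I -> x = 0) \/ (forall y, y \in J -> y = 0).

(* Main.v *)
Require Import Defs.
From HB Require Import structures.
From mathcomp Require Import all_boot all_algebra.
From mathcomp Require Import boolp classical_sets functions cardinality.

Set Implicit Arguments.
Unset Strict Implicit.
Unset Printing Implicit Defensive.

Import GRing.Theory.
Local Open Scope ring_scope.
Local Open Scope quotient_scope.

(** A prime right Sigma-V ring [R] is simple, and that settles everything: a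
    simple ring is primitive on both sides, since the annihilator of any simple
    module is a proper ideal, and a primitive ring is prime. Right [R]-modules
    are left modules over the converse ring, so the argument is about left
    modules over a ring [S] and is applied to [S := R^c].

    Let [S] be prime with all simple left modules Sigma-injective. Already
    because they are injective, [S] is fully left idempotent: each [a] of an
    ideal [I] is [b a] for some [b] in [I] ([left_V_ring_idempotent]). So an
    ideal that contains some [c] with zero left annihilator contains [1], as
    [(1 - b) c = 0]. Such elements [c] are found as in Goldie's theorem, from a
    chain condition on left annihilators ([no_triangular]) and the finiteness of
    the left uniform dimension ([no_infinite_direct_sum]).

    Both finiteness conditions come from Sigma-injectivity: if countably many
    homomorphisms from a left ideal to a simple module [T] define a map into the
    direct sum of copies of [T], the map extends to [S], and hence almost all of
    them are zero ([sigma_injective_no_triangular]). An infinite sequence in [S]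
    that violates a finiteness condition gives such homomorphisms, all nonzero,
    provided that one simple module [T] detects countably many given nonzero
    elements of [S] at once. A faithful simple module would do this, but its
    existence is part of what is to be proved. The substitute is
    [prime_left_V_ring_detect]: for any sequence of nonzero [d n], some simple
    module is annihilated by none of them. *)

(** * Submodules and quotient modules *)

Lemma submod_closedP (S : pzRingType) (V : lmodType S) (N : {pred V}) :
  submod_closed N -> [/\ 0 \in N, forall a x, x \in N -> a *: x \in N
    & forall x y, x \in N -> y \in N -> x + y \in N].
Proof.
move=> [N0 hN]; split=> // [a x xN|x y xN yN].
  by rewrite -[a *: x]addr0 hN.
by rewrite -[x]scale1r hN.
Qed.

Section Submodule.
Variables (S : pzRingType) (V : lmodType S) (K : {pred V}).

(** A copy of [K] indexed by the proof that it is a submodule, so that the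
    closure properties, and the modules built from [K], can be inferred. *)
Definition submod_pred (K_closed : submod_closed K) : {pred V} := K.

Variable K_closed : submod_closed K.

HB.instance Definition _ :=
  GRing.isSubmodClosed.Build S V (submod_pred K_closed) K_closed.

Record submodule := Submodule {
  submodule_val : V;
  _ : submodule_val \in submod_pred K_closed }.

HB.instance Definition _ := [isSub for submodule_val].
HB.instance Definition _ := [Choice of submodule by <:].
HB.instance Definition _ := [SubChoice_isSubLmodule of submodule by <:].
End Submodule.

Section Quotient.
Variables (S : pzRingType) (V : lmodType S) (K : {pred V}).
Variable K_closed : submod_closed K.

Definition quotient := Quotient.quot (submod_pred K_closed).
HB.instance Definition _ := GRing.Zmodule.on quotient.

Definition quotient_pi (x : V) : quotient := \pi x.

Lemma quotient_piP x y : (quotient_pi x = quotient_pi y) <-> x - y \in K.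
Proof. by split=> [/eqP|h]; [|apply/eqP]; rewrite -Quotient.idealrBE. Qed.

Lemma quotient_pi_surj (q : quotient) : exists x, q = quotient_pi x.
Proof. by exists (repr q); rewrite /quotient_pi reprK. Qed.

Fact quotient_pi_zmod : zmod_morphism quotient_pi.
Proof. exact: raddfB. Qed.
HB.instance Definition _ :=
  GRing.isZmodMorphism.Build V quotient quotient_pi quotient_pi_zmod.

Definition quotient_scale (a : S) (q : quotient) : quotient :=
  quotient_pi (a *: repr q).

Lemma quotient_scaleE a x :
  quotient_scale a (quotient_pi x) = quotient_pi (a *: x).
Proof.
apply/quotient_piP; rewrite -scalerBr.
have [_ KZ _] := submod_closedP K_closed; apply: KZ.
by apply/quotient_piP; rewrite /quotient_pi reprK.
Qed.

Fact quotient_scaleA a b q :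
  quotient_scale a (quotient_scale b q) = quotient_scale (a * b) q.
Proof.
by have [x ->] := quotient_pi_surj q; rewrite !quotient_scaleE scalerA.
Qed.

Fact quotient_scale1 : left_id 1 quotient_scale.
Proof.
by move=> q; have [x ->] := quotient_pi_surj q; rewrite !quotient_scaleE scale1r.
Qed.

Fact quotient_scaleDr : right_distributive quotient_scale +%R.
Proof.
move=> a q r; have [x ->] := quotient_pi_surj q.
have [y ->] := quotient_pi_surj r.
by rewrite -raddfD !quotient_scaleE scalerDr raddfD.
Qed.

Fact quotient_scaleDl q : {morph quotient_scale^~ q : a b / a + b}.
Proof.
move=> a b; have [x ->] := quotient_pi_surj q.
by rewrite !quotient_scaleE scalerDl raddfD.
Qed.

HB.instance Definition _ := GRing.Zmodule_isLmodule.Build S quotient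
  quotient_scaleA quotient_scale1 quotient_scaleDr quotient_scaleDl.

Fact quotient_pi_scalable : scalable quotient_pi.
Proof. by move=> a x; rewrite -quotient_scaleE. Qed.
HB.instance Definition _ :=
  GRing.isScalable.Build S V quotient *:%R quotient_pi quotient_pi_scalable.
End Quotient.

(** * Simple modules *)

Section MaximalSubmodule.
Variables (S : pzRingType) (V : lmodType S).

(** Zorn's lemma is applied to the sets [A] for which [N0] together with [A] is
    a submodule avoiding [v]: the empty chain then has [N0] as upper bound. *)
Lemma exists_maximal_avoiding (N0 : {pred V}) (v : V) :
    submod_closed N0 -> v \notin N0 ->
  exists N : {pred V}, [/\ submod_closed N, {subset N0 <= N}, v \notin N
    & forall N' : {pred V}, submod_closed N' -> {subset N <= N'} ->
        v \notin N' -> {subset N' <= N}].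
Proof.
move=> hN0 vN0; have [N00 N0Z N0D] := submod_closedP hN0.
pose C (A : set V) : {pred V} := fun x => (x \in N0) || `[< A x >].
have CP A x : reflect (x \in N0 \/ A x) (x \in C A).
  by apply: (iffP orP) => -[|h]; [left|right; exact/asboolP|left|
    right; apply/asboolP].
pose P A := submod_closed (C A) /\ v \notin C A.
have [|A [[hA vA] maxA]] := @Zorn_bigcup V P.
  move=> F FP Ftot; split.
    have sub A : F A -> {subset C A <= C (\bigcup_(X in F) X)%classic}.
      by move=> FA x /CP[xN|Ax]; apply/CP; [left|right; exists A].
    split=> [|a x y /CP hx /CP hy]; first by apply/CP; left.
    have [[A FA [xA yA]]|[xN yN]] :
        (exists2 A, F A & x \in C A /\ y \in C A) \/ (x \in N0 /\ y \in N0).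
      case: hx => [xN|[A FA Ax]]; case: hy => [yN|[B FB By]].
      - by right.
      - by left; exists B => //; split; apply/CP; [left|right].
      - by left; exists A => //; split; apply/CP; [right|left].
      - left; have [AB|BA] := Ftot _ _ FA FB.
          by exists B => //; split; apply/CP; right => //; exact: AB.
        by exists A => //; split; apply/CP; right => //; exact: BA.
      apply: (sub A FA); have [[_ hA] _] := FP _ FA; exact: hA.
    by apply/CP; left; apply: hN0.2.
  apply/negP => /CP[|[A FA Av]]; first exact/negP.
  by have [_ /negP] := FP _ FA; apply; apply/CP; right.
exists (C A); split=> // [x xN|N' hN' sAN' vN' x xN']; first by apply/CP; left.
have CN' : C [set` N']%classic =i N'.
  move=> y; apply/CP/idP => [[yN0|//]|yN']; last by right.
  by apply: sAN'; apply/CP; left.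
apply: contrapT => /negP xA.
apply: (maxA [set` N']%classic); last first.
  split; last by rewrite CN'.
  by case: hN' => h0 hD; split=> [|a y z]; rewrite !CN' //; exact: hD.
split; first by move=> y Ay; apply: sAN'; apply/CP; right.
by move=> /(_ x xN') Ax; move/negP: xA; apply; apply/CP; right.
Qed.

(** A submodule [N] maximal among those that contain [N0] and avoid [v] makes
    the line through the class of [v] the least nonzero submodule of [V / N];
    this line is [T] and [V / N] is [U]. *)
Lemma exists_simple_subquotient (N0 : {pred V}) (v : V) :
    submod_closed N0 -> v \notin N0 ->
  exists (T U : lmodType S) (p : {linear V -> U}) (i : {linear T -> U}) (t : T),
  [/\ simple_module T, injective i, forall x, x \in N0 -> p x = 0,
      i t = p v & t != 0].
Proof.
move=> hN0 vN0.
have [N [hN sN vN maxN]] := exists_maximal_avoiding hN0 vN0.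
pose U : lmodType S := quotient hN.
pose p : {linear V -> U} := @quotient_pi S V N hN.
have p0 x : p x = 0 <-> x \in N.
  by rewrite -(raddf0 p) quotient_piP subr0.
pose L : {pred U} := fun q => `[< exists a, q = a *: p v >].
have hL : submod_closed L.
  split=> [|a q r /asboolP[b ->] /asboolP[c ->]]; apply/asboolP.
    by exists 0; rewrite scale0r.
  by exists (a * b + c); rewrite scalerDl scalerA.
pose T : lmodType S := submodule hL.
pose i : {linear T -> U} := val.
have pvL : p v \in submod_pred hL.
  by apply/asboolP; exists 1; rewrite scale1r.
pose t : T := Submodule pvL.
have iI : injective i by exact: val_inj.
have t0 : t != 0.
  by rewrite -(inj_eq iI) raddf0; apply/eqP => /p0; apply/negP.
exists T, U, p, i, t; split=> //; last by move=> x /sN xN; apply/p0.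
split; first by exists t.
move=> M hM; have [M0 MZ MD] := submod_closedP hM.
  pose N' : {pred V} := fun x => `[< exists2 m : T, m \in M & p x = i m >].
  have hN' : submod_closed N'.
    split=> [|a x y /asboolP[m mM xm] /asboolP[n nM yn]]; apply/asboolP.
      by exists (0 : T); [exact: M0 | rewrite !raddf0].
    exists (a *: m + n); first exact: hM.2.
    by rewrite !linearP xm yn.
  have sNN' : {subset N <= N'}.
    move=> x xN; apply/asboolP; exists (0 : T); first exact: M0.
    by rewrite raddf0; apply/p0.
  have [vN'|vN'] := boolP (v \in N'); [right|left] => x.
    have xL : i x \in L := valP x.
    have /asboolP[a xa] := xL.
    have /asboolP[m mM vm] := vN'.
    have -> : x = a *: m.
      by apply: iI; rewrite linearZ -vm.
    exact: MZ.
  move=> xM; have [y xy] := quotient_pi_surj (i x).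
  have yN' : y \in N' by apply/asboolP; exists x.
  have /p0 := maxN _ hN' sNN' vN' _ yN'.
  by move=> py0; apply: iI; rewrite xy raddf0.
Qed.

End MaximalSubmodule.

(** The case [V = S], [v = 1]. The vector [t] stands for the class of
    [1]. *)
Lemma exists_simple_killed (S : pzRingType) (N0 : {pred S^o}) :
    submod_closed N0 -> (1 : S) \notin N0 ->
  exists (T : lmodType S) (t : T),
  [/\ simple_module T, t != 0 & forall s : S, (s : S^o) \in N0 -> s *: t = 0].
Proof.
move=> hN0 N01.
have [T [U [p [i [t [Ts iI pN it t0]]]]]] := exists_simple_subquotient hN0 N01.
exists T, t; split=> // s sN; apply: iI; rewrite linearZ raddf0 /= it.
by rewrite -linearZ /= -[s *: _]/(s * 1) mulr1 pN.
Qed.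

(** * Using injectivity *)

(** A module is a retract of its copower over a one-element set. *)
Lemma sigma_injectiveW (S : pzRingType) (T : lmodType S) :
  sigma_injective T -> injective_module T.
Proof.
move=> sT A B f g fI.
have dP (x : T) : (fun _ : unit => x) \in finite_support (I := unit) (M := T).
  by apply/asboolP; exact: finite_finset.
pose d (x : T) : copower unit T := Copower (dP x).
have d_lin : linear d by move=> a x y; apply: val_inj; apply/funext.
pose dL : {linear T -> copower unit T} :=
  HB.pack d (GRing.isLinear.Build S T (copower unit T) *:%R d d_lin).
have [h hE] := sT unit A B f (dL \o g) fI.
pose e (u : copower unit T) : T := u tt.
have e_lin : linear e by [].
pose eL : {linear copower unit T -> T} :=
  HB.pack e (GRing.isLinear.Build S (copower unit T) T *:%R e e_lin).
by exists (eL \o h) => x /=; rewrite hE.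
Qed.

Lemma injective_extend (S : pzRingType) (E V : lmodType S) (K : {pred V})
    (K_closed : submod_closed K) (g : submodule K_closed -> E) :
    injective_module E -> linear g ->
  exists h : {linear V -> E}, forall x : submodule K_closed, h (val x) = g x.
Proof.
move=> hE g_lin.
pose gL : {linear submodule K_closed -> E} :=
  HB.pack g (GRing.isLinear.Build S (submodule K_closed) E *:%R g g_lin).
exact: (hE _ _ (\val : {linear submodule K_closed -> V}) gL val_inj).
Qed.

(** As [K] and [L] meet in zero, [K * L] embeds in [V] by addition; extend the
    map that is zero on [K] and [f] on [L]. *)
Lemma injective_separate (S : pzRingType) (E V : lmodType S)
    (K L : {pred V}) (f : {linear V -> E}) :
    injective_module E -> submod_closed K -> submod_closed L ->
    (forall x, x \in K -> x \in L -> x = 0) ->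
  exists h : {linear V -> E},
    (forall x, x \in K -> h x = 0) /\ (forall x, x \in L -> h x = f x).
Proof.
move=> hE hK hL KL.
pose A : lmodType S := (submodule hK * submodule hL)%type.
pose s (z : A) : V := val z.1 + val z.2.
have s_lin : linear s.
  by move=> a x y; rewrite /s /= scalerDr addrACA.
pose sL : {linear A -> V} :=
  HB.pack s (GRing.isLinear.Build S A V *:%R s s_lin).
pose g (z : A) : E := f (val z.2).
have g_lin : linear g by move=> a x y; rewrite /g /= linearP.
pose gL : {linear A -> E} :=
  HB.pack g (GRing.isLinear.Build S A E *:%R g g_lin).
have sI : injective sL.
  apply: raddf_inj => -[x y] /= /eqP; rewrite addr_eq0 => /eqP xy.
  have x0 : val x = 0.
    apply: KL; first exact: valP.
    rewrite xy -scaleN1r; have [_ LZ _] := submod_closedP hL.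
    by apply: LZ; exact: valP.
  have y0 : val y = 0 by apply/eqP; rewrite -oppr_eq0 -xy x0.
  by congr (_, _); apply: val_inj.
have [h hE'] := hE _ _ sL gL sI; exists h; split=> x xP.
  have := hE' (Submodule (xP : x \in submod_pred hK), 0).
  by rewrite /= /s /g /= addr0 linear0.
have := hE' (0, Submodule (xP : x \in submod_pred hL)).
by rewrite /= /s /g /= add0r.
Qed.

(** The vectors [x n] define a homomorphism [s |-> (s *: x n)_n] from the left
    ideal of the [s] that annihilate almost all of them to the direct sum of
    copies of [T]. It extends to [S], so it is given by a single vector of the
    direct sum, and therefore only finitely many coordinates of it are not
    zero. *)
Lemma sigma_injective_no_triangular (S : pzRingType) (T : lmodType S)
    (x : nat -> T) (k : nat -> S) :
    sigma_injective T ->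
    (forall m n, (n < m)%N -> k n *: x m = 0) ->
  exists n, k n *: x n = 0.
Proof.
move=> sT kx; apply: contrapT => /forallNP kn0.
pose K : {pred S^o} :=
  fun s => `[< exists N, forall m, (N <= m)%N -> (s : S) *: x m = 0 >].
have hK : submod_closed K.
  split=> [|a u v /asboolP[N hN] /asboolP[M hM]]; apply/asboolP.
    by exists 0%N => m _; rewrite scale0r.
  exists (maxn N M) => m; rewrite geq_max => /andP[Nm Mm].
  by rewrite scalerDl -scalerA hN// hM// scaler0 addr0.
have gP (s : submodule hK) :
    (fun m => (val s : S) *: x m) \in finite_support (I := nat) (M := T).
  apply/asboolP; have sK : val s \in K := valP s.
  have /asboolP[N hN] := sK.
  apply: (@sub_finite_set _ _ `I_N) => [m /= sm|]; last exact: finite_II.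
  by rewrite ltnNge; apply/negP => /hN.
pose g (s : submodule hK) : copower nat T := Copower (gP s).
have g_lin : linear g.
  move=> a u v; apply: val_inj; apply/funext => m /=.
  by rewrite scalerDl -scalerA.
have copowerI := sT nat.
have [h hg] := injective_extend copowerI g_lin.
pose t : copower nat T := h 1.
have tE n : (k n *: (t n : T)) = k n *: x n.
  have kK : (k n : S^o) \in submod_pred hK.
    by apply/asboolP; exists n.+1 => m /kx.
  have := hg (Submodule kK) => /(congr1 (fun u : copower nat T => u n)) /= <-.
  by rewrite -[in RHS](mulr1 (k n)) -[k n * 1]/(k n *: (1 : S^o)) linearZ.
have /asboolP tfin := valP t.
have : finite_set [set: nat].
  apply: sub_finite_set tfin => n _ /= tn0.
  by apply: (kn0 n); rewrite -tE tn0 scaler0.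
exact: infinite_nat.
Qed.

(** * Prime rings and V-rings *)

Section TwoSidedIdeals.
Variable S : pzRingType.

Definition annihilator (T : lmodType S) : {pred S} :=
  fun s => `[< forall t : T, s *: t = 0 >].

Lemma annihilator_ideal (T : lmodType S) : two_sided_ideal (annihilator T).
Proof.
split; first split=> [|x y /asboolP hx /asboolP hy].
- by apply/asboolP => t; rewrite scale0r.
- by apply/asboolP => t; rewrite scalerBl hx hy subr0.
move=> a x /asboolP hx; split; apply/asboolP => t.
  by rewrite -scalerA hx scaler0.
by rewrite -scalerA hx.
Qed.

Definition ideal_gen (a : S) : {pred S} :=
  fun x => `[< forall I : {pred S}, two_sided_ideal I -> a \in I -> x \in I >].

Lemma ideal_gen_mem a : a \in ideal_gen a.
Proof. exact/asboolP. Qed.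

Lemma ideal_gen_ideal a : two_sided_ideal (ideal_gen a).
Proof.
split; first split=> [|x y /asboolP hx /asboolP hy].
- by apply/asboolP => I [[]].
- apply/asboolP => I hI aI; have [[_ IB] _] := hI.
  by apply: IB; [exact: hx | exact: hy].
move=> c x /asboolP hx; split; apply/asboolP => I hI aI; have [_ IM] := hI.
  by have [] := IM c x (hx I hI aI).
by have [] := IM c x (hx I hI aI).
Qed.

Lemma ideal_gen_sub (a : S) (I : {pred S}) :
  two_sided_ideal I -> a \in I -> {subset ideal_gen a <= I}.
Proof. by move=> hI aI x /asboolP; exact. Qed.

(** If [a S b = 0], then the ideal of all [x] with [x S b = 0] and its right
    annihilator have zero product; the first contains [a], the second [b]. *)
Lemma prime_ring_mul_neq0 (a b : S) :
  prime_ring S -> a != 0 -> b != 0 -> exists u, a * u * b != 0.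
Proof.
move=> [_ primeS] a0 b0; apply: contrapT => /forallNP aub.
pose I : {pred S} := fun x => `[< forall u, x * u * b = 0 >].
pose J : {pred S} := fun y => `[< forall x, x \in I -> x * y = 0 >].
have hI : two_sided_ideal I.
  split; first split=> [|x y /asboolP hx /asboolP hy].
  - by apply/asboolP => u; rewrite !mul0r.
  - by apply/asboolP => u; rewrite !mulrBl hx hy subr0.
  move=> c x /asboolP hx; split; apply/asboolP => u.
    by rewrite -!mulrA [x * _]mulrA hx mulr0.
  by rewrite -(mulrA x).
have hJ : two_sided_ideal J.
  split; first split=> [|x y /asboolP hx /asboolP hy].
  - by apply/asboolP => u _; rewrite mulr0.
  - by apply/asboolP => u uI; rewrite mulrBr hx// hy// subr0.
  move=> c x /asboolP hx; split; apply/asboolP => u uI; rewrite mulrA ?hx ?mul0r//.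
  by have [] := hI.2 c u uI.
have IJ x y : x \in I -> y \in J -> x * y = 0 by move=> xI /asboolP; exact.
have [I0|J0] := primeS I J hI hJ IJ.
  move/eqP: a0; apply; apply: I0; apply/asboolP => u.
  by apply/eqP/negPn/negP => /aub.
move/eqP: b0; apply; apply: J0; apply/asboolP => x /asboolP hx.
by rewrite -(hx 1) mulr1.
Qed.

Definition left_V_ring :=
  forall T : lmodType S, simple_module T -> injective_module T.

(** Left V-rings are fully left idempotent. If [a] is not in [I a], then a
    simple module [T] inside a quotient of [S / I a] contains the class of [a].
    By injectivity [S / I a] maps to [T] with [a] going to some [t != 0], so
    [t = a *: w] where [w] is the image of [1]. But [I] kills [t], hence kills
    the simple module [T], and [t] is zero. *)
Lemma left_V_ring_idempotent (I : {pred S}) (a : S) :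
  left_V_ring -> two_sided_ideal I -> a \in I ->
  exists2 b, b \in I & b * a = a.
Proof.
move=> hV hI aI; have [[I0 IB] IM] := hI.
have ID x y : x \in I -> y \in I -> x + y \in I.
  by move=> xI yI; rewrite -[y]opprK IB// -sub0r IB.
pose N0 : {pred S^o} := fun x => `[< exists2 b, b \in I & x = b * a >].
have hN0 : submod_closed N0.
  split=> [|c x y /asboolP[b bI ->] /asboolP[d dI ->]]; apply/asboolP.
    by exists 0; rewrite ?mul0r.
  exists (c * b + d); last by rewrite mulrDl -[c *: _]/(c * _) mulrA.
  by rewrite ID//; have [] := IM c b bI.
have [/asboolP[b bI ab]|aN0] := boolP ((a : S^o) \in N0); first by exists b.
have [T [U [p [i [t [Ts iI pN it t0]]]]]] := exists_simple_subquotient hN0 aN0.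
have [h hi] := hV T Ts T U i idfun iI.
have pE (s : S) : p (s : S^o) = s *: p 1.
  by rewrite -linearZ -[s *: _]/(s * 1) mulr1.
have tE : t = h (p (a : S^o)) by rewrite -it hi.
have ta : t = a *: h (p 1) by rewrite -linearZ -pE.
pose K : {pred T} := fun x => `[< forall b, b \in I -> b *: x = 0 >].
have hK : submod_closed K.
  split=> [|c x y /asboolP hx /asboolP hy]; apply/asboolP => b bI.
    by rewrite scaler0.
  rewrite scalerDr scalerA hx ?hy ?addr0//.
  by have [] := IM c b bI.
have [K0|KT] := Ts.2 K hK.
  have tK : t \in K.
    apply/asboolP => b bI; rewrite tE -linearZ -linearZ pN ?linear0//.
    by apply/asboolP; exists b.
  by move: t0; rewrite (K0 t tK) eqxx.
have /asboolP /(_ a aI) := KT (h (p 1)).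
by rewrite -ta => t00; rewrite t00 eqxx in t0.
Qed.

(** Primeness gives nonzero [y n] with [y n.+1] in [y n * S * d n]. Take [b n]
    in the ideal of [y n.+1] with [b n * y n.+1 = y n.+1]. The left annihilators
    of the [y n] increase with [n], so their union is a proper left ideal, and
    it contains every [1 - b n]. Hence each [b n] fixes one and the same nonzero
    vector of a simple module [T], so neither [y n.+1] nor [d n] kills [T]. *)
Lemma prime_left_V_ring_detect (d : nat -> S) :
    left_V_ring -> prime_ring S -> (forall n, d n != 0) ->
  exists2 T : lmodType S, simple_module T &
    forall n, exists t : T, d n *: t != 0.
Proof.
move=> hV hP d0.
have [|f fE] := @choice (S * nat) S
    (fun c u => c.1 != 0 -> c.1 * u * d c.2 != 0).
  move=> [a n] /=.
  have [->|a0] := eqVneq a 0; first by exists 0.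
  by have [u au] := prime_ring_mul_neq0 hP a0 (d0 n); exists u.
pose y := fix y n := if n is m.+1 then y m * f (y m, m) * d m else 1.
have y0 n : y n != 0.
  elim: n => [|n yn]; first by apply/eqP; have [] := hP.
  exact: (fE (y n, n)).
have ymn m n (s : S) : (m <= n)%N -> s * y m = 0 -> s * y n = 0.
  move=> /subnK <- sm; elim: (n - m)%N => [//|j IH].
  by rewrite addSn /= !mulrA IH !mul0r.
have [|b bE] := @choice nat S
    (fun n b => b \in ideal_gen (y n.+1) /\ b * y n.+1 = y n.+1).
  move=> n; have [b bI by_] := left_V_ring_idempotent hV
    (ideal_gen_ideal (y n.+1)) (ideal_gen_mem (y n.+1)).
  by exists b.
pose N0 : {pred S^o} := fun s => `[< exists n, (s : S) * y n = 0 >].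
have hN0 : submod_closed N0.
  split=> [|c u v /asboolP[m um] /asboolP[n vn]]; apply/asboolP.
    by exists 0%N; rewrite mul0r.
  exists (maxn m n); rewrite mulrDl -[c *: u]/(c * u) -mulrA.
  by rewrite (ymn m) ?leq_maxl// (ymn n) ?leq_maxr// mulr0 addr0.
have N01 : (1 : S) \notin N0.
  by apply/negP => /asboolP[n]; rewrite mul1r; apply/eqP.
have [T [t [Ts t0 tN]]] := exists_simple_killed hN0 N01.
exists T => // n; apply: contrapT => /forallNP dT.
have dA : d n \in annihilator T.
  by apply/asboolP => x; apply/eqP/negPn/negP/dT.
have yA : y n.+1 \in annihilator T.
  by have [] := (annihilator_ideal T).2 (y n * f (y n, n)) _ dA.
have [bI by_] := bE n.
have /asboolP/(_ t) bt := ideal_gen_sub (annihilator_ideal T) yA bI.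
have : (1 - b n) *: t = 0.
  by apply: tN; apply/asboolP; exists n.+1; rewrite mulrBl by_ mul1r subrr.
by rewrite scalerBl scale1r bt subr0; apply/eqP.
Qed.

End TwoSidedIdeals.

(** * Prime sigma-V rings are simple *)

Lemma dependent_choice_on (X : Type) (P : X -> Prop) (R : X -> X -> Prop)
    (x0 : X) :
    P x0 -> (forall x, P x -> exists2 y, P y & R x y) ->
  exists f : nat -> X, forall n, P (f n) /\ R (f n) (f n.+1).
Proof.
move=> Px0 PR.
have [f [f0 fR]] : {f : nat -> X | f 0%N = x0 /\
    forall n, P (f n) -> P (f n.+1) /\ R (f n) (f n.+1)}.
  apply: (@dependent_choice X (fun x y => P x -> P y /\ R x y)) => x.
  apply: cid; have [Px|nPx] := pselect (P x); last by exists x.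
  by have [y Py Rxy] := PR x Px; exists y.
have Pf n : P (f n) by elim: n => [|n /fR[]//]; rewrite f0.
by exists f => n; split; [exact: Pf|exact: (fR n (Pf n)).2].
Qed.

Section PrimeSigmaV.
Variable S : pzRingType.
Hypothesis S_sigma_V :
  forall T : lmodType S, simple_module T -> sigma_injective T.
Hypothesis S_prime : prime_ring S.

Let S_V : left_V_ring S.
Proof. by move=> T /S_sigma_V/sigma_injectiveW. Qed.

(** A form of the ascending chain condition on left annihilators: a strictly
    ascending chain of them, of [b m] say, gives [k n] annihilating [b m] for
    [m > n] but not [b n]. *)
Lemma no_triangular (b k : nat -> S) :
  (forall m n, (n < m)%N -> k n * b m = 0) -> exists n, k n * b n = 0.
Proof.
move=> kb; apply: contrapT => /forallNP kbn.
have kb0 n : k n * b n != 0 by apply/eqP/kbn.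
have [T Ts kT] := prime_left_V_ring_detect S_V S_prime kb0.
have [t tP] := choice kT.
have [m n nm|n] := @sigma_injective_no_triangular S T (fun m => b m *: t m) k
  (S_sigma_V Ts).
  by rewrite scalerA kb// scale0r.
by rewrite scalerA; apply/eqP/tP.
Qed.

(** Finiteness of the left uniform dimension: there is no infinite direct sum
    of nonzero left ideals [S (a n)]. With [T] simple and [a n *: t n != 0], the
    injectivity of [T] replaces [t n] by a vector [x n] on which [a n] acts in
    the same way, but which is killed by [L n], thus by all [a m] with
    [m < n]. *)
Lemma no_infinite_direct_sum (L : nat -> {pred S^o}) (a : nat -> S) :
    (forall n, submod_closed (L n)) ->
    (forall n, {subset L n <= L n.+1}) -> (forall n, (a n : S^o) \in L n.+1) ->
    (forall n s, ((s * a n : S) : S^o) \in L n -> s * a n = 0) ->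
  exists n, a n = 0.
Proof.
move=> hL Lmono aL La0; apply: contrapT => /forallNP an0.
have a0 n : a n != 0 by apply/eqP/an0.
have [T Ts aT] := prime_left_V_ring_detect S_V S_prime a0.
have [t tP] := choice aT.
have xP n : exists x : T, (forall s : S, (s : S^o) \in L n -> s *: x = 0) /\
    a n *: x = a n *: t n.
  pose K : {pred S^o} := fun s => `[< exists r : S, s = r * a n >].
  have hK : submod_closed K.
    split=> [|c u v /asboolP[r ->] /asboolP[q ->]]; apply/asboolP.
      by exists 0; rewrite mul0r.
    by exists (c * r + q); rewrite mulrDl -mulrA.
  pose f (s : S^o) : T := (s : S) *: t n.
  have f_lin : linear f by move=> c u v; rewrite /f scalerDl scalerA.
  pose fL : {linear S^o -> T} :=
    HB.pack f (GRing.isLinear.Build S S^o T *:%R f f_lin).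
  have LK (s : S^o) : s \in L n -> s \in K -> s = 0.
    by move=> sL /asboolP[r sr]; rewrite sr; apply: La0; rewrite -sr.
  have [h [hL0 hK1]] := injective_separate fL (S_V Ts) (hL n) hK LK.
  have hE (s : S) : s *: h 1 = h s by rewrite -linearZ -[s *: _]/(s * 1) mulr1.
  exists (h 1); split=> [s sL|]; rewrite hE; first exact: hL0.
  by apply: hK1; apply/asboolP; exists 1; rewrite mul1r.
have [x {}xP] := choice xP.
have [m n nm|n] := @sigma_injective_no_triangular S T x a (S_sigma_V Ts).
  apply: (xP m).1; rewrite -(subnK nm); elim: (m - n.+1)%N => [|j IH].
    exact: aL.
  by rewrite addSn; apply: Lmono.
by rewrite (xP n).2; apply/eqP/tP.
Qed.

(** Suppose that the left ideal [K] is nil, and let [a != 0] be in [x S] with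
    [x] in [K]. By primeness some [a u a] is not zero; [a u] is nilpotent, and
    its last nonzero power [a'] is a right multiple of [a] killed by [a u].
    Iterating gives a strictly ascending chain of left annihilators. *)
Lemma left_ideal_nonnil (K : {pred S^o}) (x : S) :
    submod_closed K -> (x : S^o) \in K -> x != 0 ->
  exists2 a : S, (a : S^o) \in K & forall n, a ^+ n != 0.
Proof.
move=> hK xK x0; apply: contrapT => /forall2NP nilK.
have {}nilK (a : S) : (a : S^o) \in K -> exists n, a ^+ n = 0.
  move=> aK; apply: contrapT => /forallNP an.
  by have [] := nilK a => // -[] n; apply/eqP/an.
have [_ KZ _] := submod_closedP hK.
have nilx z : exists n, (x * z) ^+ n = 0.
  have [n zxn] := nilK (z * x) (KZ z _ xK).
  exists n.+1; suff -> : (x * z) ^+ n.+1 = x * (z * x) ^+ n * z.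
    by rewrite zxn mulr0 mul0r.
  elim: n {zxn} => [|n IH]; first by rewrite expr1 expr0 mulr1.
  by rewrite exprS IH [in RHS]exprS !mulrA.
pose P (a : S) := a != 0 /\ exists w, a = x * w.
pose Q (a a' : S) :=
  exists u, [/\ exists v, a' = a * v, a * u * a' = 0 & a * u * a != 0].
have PQ a : P a -> exists2 a', P a' & Q a a'.
  move=> [a0 [w aw]]; have [u aua] := prime_ring_mul_neq0 S_prime a0 a0.
  have cnil : exists n, (a * u) ^+ n == 0.
    by have [n xn] := nilx (w * u); exists n; rewrite aw -mulrA xn.
  case: (ex_minnP cnil) => -[|[|n]] cn0 nmin.
  - move: aua.
    by rewrite -[_ * _ * _]mul1r -(expr0 (a * u)) (eqP cn0) mul0r eqxx.
  - by move: aua; rewrite -(expr1 (a * u)) (eqP cn0) mul0r eqxx.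
  have cE : (a * u) ^+ n.+1 = a * (u * (a * u) ^+ n) by rewrite exprS mulrA.
  exists ((a * u) ^+ n.+1).
    split; first by apply/negP => /nmin; rewrite ltnn.
    by exists (w * (u * (a * u) ^+ n)); rewrite cE [X in X * _]aw -mulrA.
  exists u; split=> //; first by exists (u * (a * u) ^+ n).
  by rewrite -exprS (eqP cn0).
have Px : P x by split=> //; exists 1; rewrite mulr1.
have [a aP] := dependent_choice_on Px PQ.
have [u uP] := choice (fun n => (aP n).2).
have [m n nm|n] := @no_triangular a (fun n => a n * u n).
  rewrite -(subnK nm); elim: (m - n.+1)%N => [|j IH]; first by have [] := uP n.
  by rewrite addSn; have [[v ->] _ _] := uP (j + n.+1)%N; rewrite mulrA IH mul0r.
by have [_ _ /eqP] := uP n.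
Qed.

(** A high power of a non-nilpotent element will do, by the chain condition
    applied to the left annihilators of its powers. *)
Lemma left_ideal_square_regular (K : {pred S^o}) (x : S) :
    submod_closed K -> (x : S^o) \in K -> x != 0 ->
  exists c : S, [/\ (c : S^o) \in K, c != 0
    & forall s, s * c * c = 0 -> s * c = 0].
Proof.
move=> hK xK x0; have [a aK an0] := left_ideal_nonnil hK xK x0.
have [_ KZ _] := submod_closedP hK.
have [n nP] : exists n, forall s, s * a ^+ n.+1 = 0 -> s * a ^+ n = 0.
  apply: contrapT => /forallNP nP.
  have sP n : exists s, s * a ^+ n.+1 = 0 /\ s * a ^+ n <> 0.
    by have /existsNP[s /not_implyP sn] := nP n; exists s.
  have [k kP] := choice sP.
  have [m n nm|n] := @no_triangular (fun n => a ^+ n) k; last exact: (kP n).2.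
  by rewrite -(subnKC nm) exprD mulrA (kP n).1 mul0r.
have njP j s : s * a ^+ (j + n) = 0 -> s * a ^+ n = 0.
  elim: j => [//|j IH]; rewrite addSnnS exprD mulrA => /nP.
  by rewrite -mulrA -exprD; exact: IH.
exists (a ^+ n.+1); split=> // [|s]; first by rewrite exprSr; exact: KZ.
have -> : s * a ^+ n.+1 * a ^+ n.+1 = s * a ^+ (n.+2 + n).
  by rewrite -mulrA -exprD addnS.
by move=> /njP; rewrite exprSr mulrA => ->; rewrite mul0r.
Qed.

(** Build a direct sum [L] of left ideals [S a] inside [I] together with an
    element [c] of [L] that no nonzero element of [L] annihilates. As long as
    some [s0 != 0] annihilates [c], the ideal [I] contains nonzero elements that
    annihilate [c]; pick [a] among them with [s * a * a = 0 -> s * a = 0], and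
    pass to [L + S a] and [c + a]. This stops by the finiteness of uniform
    dimension. *)
Lemma ideal_right_regular (I : {pred S}) (x : S) :
    two_sided_ideal I -> x \in I -> x != 0 ->
  exists2 c, c \in I & forall s, s * c = 0 -> s = 0.
Proof.
move=> hI xI x0; apply: contrapT => /forall2NP nreg.
have [[I0 IB] IM] := hI.
have ID y z : y \in I -> z \in I -> y + z \in I.
  by move=> yI zI; rewrite -[z]opprK IB// -sub0r IB.
pose P (q : {pred S^o} * S) := [/\ submod_closed q.1, q.2 \in I,
  (q.2 : S^o) \in q.1 & forall s : S, (s : S^o) \in q.1 -> s * q.2 = 0 -> s = 0].
pose Q (q q' : {pred S^o} * S) := exists a : S, [/\ a != 0, {subset q.1 <= q'.1},
  (a : S^o) \in q'.1 & forall s : S, ((s * a : S) : S^o) \in q.1 -> s * a = 0].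
pose L0 : {pred S^o} := pred1 0.
have P0 : P (L0, 0).
  split=> /=; [|exact: I0|exact: eqxx|by move=> s /eqP].
  split=> [|c u v /eqP-> /eqP->]; first exact: eqxx.
  by rewrite scaler0 addr0; exact: eqxx.
have PQ q : P q -> exists2 q', P q' & Q q q'.
  case: q => L c [/= hL cI cL Lc]; have [_ LZ LD] := submod_closedP hL.
  have [//|/existsNP[s0 /not_implyP[s0c /eqP s00]]] := nreg c.
  have [u xus] := prime_ring_mul_neq0 S_prime x0 s00.
  pose K : {pred S^o} := fun s => (s \in I) && ((s : S) * c == 0).
  have hK : submod_closed K.
    split=> [|d y z /andP[yI /eqP yc] /andP[zI /eqP zc]]; apply/andP.
      by rewrite mul0r eqxx.
    split; first by apply: ID => //; have [] := IM d y yI.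
    by rewrite mulrDl zc addr0 -[d *: y]/(d * y) -mulrA yc mulr0.
  have xK : (x * u * s0 : S^o) \in K.
    apply/andP; split; last by rewrite -mulrA s0c mulr0.
    by rewrite -mulrA; have [] := IM (u * s0) x xI.
  have [a [/andP[aI /eqP ac] a0 aa]] := left_ideal_square_regular hK xK xus.
  have La s : ((s * a : S) : S^o) \in L -> s * a = 0.
    by move=> /Lc; apply; rewrite -mulrA ac mulr0.
  (* The next sum [L + S a]; it is direct by [La]. *)
  pose L' : {pred S^o} := fun s =>
    `[< exists2 l : S^o, l \in L & exists r : S, s = l + r * a >].
  have LL' : {subset L <= L'}.
    by move=> l lL; apply/asboolP; exists l => //; exists 0; rewrite mul0r addr0.
  have aL' : (a : S^o) \in L'.
    apply/asboolP; exists 0; first exact: hL.1.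
    by exists 1; rewrite mul1r add0r.
  have hL' : submod_closed L'.
    split=> [|d y z /asboolP[l lL [r ->]] /asboolP[l' lL' [r' ->]]].
      exact: (LL' _ hL.1).
    apply/asboolP; exists (d *: l + l'); first by apply: LD => //; exact: LZ.
    exists (d * r + r').
    by rewrite scalerDr addrACA mulrDl -mulrA.
  have [_ _ LD'] := submod_closedP hL'.
  exists (L', c + a); last by exists a; split.
  split=> //=; first exact: ID.
    by apply: LD' => //; exact: LL'.
  move=> s sL' sca.
  have sc : s * c = 0.
    apply: Lc; first exact: LZ.
    (* [s * c] is in [L], and being [- s * a] it annihilates [c]. *)
    have -> : s * c = - (s * a) by apply/eqP; rewrite -addr_eq0 -mulrDr sca.
    by rewrite mulNr -mulrA ac mulr0 oppr0.
  have sa : s * a = 0 by rewrite -sca mulrDr sc add0r.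
  have /asboolP[l lL [r sE]] := sL'.
  have l0 : l = 0.
    by apply: Lc => //; rewrite -[RHS]sc sE mulrDl -mulrA ac mulr0 addr0.
  by move: sa; rewrite sE l0 add0r; exact: aa.
have [f fP] := dependent_choice_on P0 PQ.
have [a aP] := choice (fun n => (fP n).2).
have [n||n||n] := @no_infinite_direct_sum (fun n => (f n).1) a.
- by have [[]] := fP n.
- by move=> n; have [] := aP n.
- by have [] := aP n.
- by move=> n; have [] := aP n.
by have [/eqP] := aP n.
Qed.

(** With [c] in [I] right regular and [b * c = c] for some [b] in [I], the
    element [1 - b] annihilates [c] and is zero. *)
Lemma prime_sigma_V_ring_simple (I : {pred S}) (x : S) :
  two_sided_ideal I -> x \in I -> x != 0 -> 1 \in I.
Proof.
move=> hI xI x0; have [c cI creg] := ideal_right_regular hI xI x0.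
have [b bI bc] := left_V_ring_idempotent S_V hI cI.
suff /eqP : 1 - b = 0 by rewrite subr_eq0 => /eqP ->.
by apply: creg; rewrite mulrBl bc mul1r subrr.
Qed.

End PrimeSigmaV.

(** * Primitive rings *)

(** If [I J = 0], then [J] maps the faithful simple module [T] into the
    submodule [K] of the vectors killed by [I], which is zero or [T]. *)
Lemma left_primitive_prime (S : pzRingType) : left_primitive S -> prime_ring S.
Proof.
move=> [T [Ts Tf]]; split=> [S1|I J hI hJ IJ].
  by have [t] := Ts.1; rewrite -[t]scale1r S1 scale0r eqxx.
pose K : {pred T} := fun t => `[< forall x, x \in I -> x *: t = 0 >].
have hK : submod_closed K.
  split=> [|a t u /asboolP ht /asboolP hu]; apply/asboolP => x xI.
    by rewrite scaler0.
  rewrite scalerDr scalerA ht ?hu ?addr0//.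
  by have [] := hI.2 a x xI.
have [K0|KT] := Ts.2 K hK; [right=> y yJ|left=> x xI]; apply: Tf => t.
  by apply: K0; apply/asboolP => x xI; rewrite scalerA IJ// scale0r.
by have /asboolP := KT t; apply.
Qed.

(** Any simple module is faithful, its annihilator being a proper ideal. *)
Lemma simple_ring_left_primitive (S : pzRingType) :
    (1 : S) <> 0 ->
    (forall (I : {pred S}) (x : S),
      two_sided_ideal I -> x \in I -> x != 0 -> 1 \in I) ->
  left_primitive S.
Proof.
move=> S1 Ss.
have h0 : submod_closed (pred1 (0 : S^o)).
  split=> [|c u v /eqP-> /eqP->]; first exact: eqxx.
  by rewrite scaler0 addr0; exact: eqxx.
have [|T [t [Ts t0 _]]] := exists_simple_killed h0; first exact/eqP.
exists T; split=> // a aT; apply: contrapT => /eqP a0.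
have aA : a \in annihilator T by exact/asboolP.
have /asboolP/(_ t) := Ss _ _ (annihilator_ideal T) aA a0.
by rewrite scale1r; apply/eqP.
Qed.

Lemma two_sided_ideal_converse (R : pzRingType) (I : {pred R}) :
  two_sided_ideal (I : {pred R^c}) <-> two_sided_ideal I.
Proof. by split=> -[h hM]; split=> // a x /(hM a)[]. Qed.

Lemma prime_ring_converse (R : pzRingType) : prime_ring R^c <-> prime_ring R.
Proof.
split=> -[R1 hR]; split=> // I J hI hJ IJ.
  have [||x y xJ yI|J0|I0] := hR J I; [exact/two_sided_ideal_converse..| | |].
  - exact: IJ.
  - by right.
  - by left.
have [||x y xJ yI|J0|I0] := hR J I; [exact/two_sided_ideal_converse..| | |].
- exact: IJ.
- by right.
- by left.
Qed.

Theorem theorem3p1 (R : pzRingType) (hR : right_sigma_V_ring R) :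
  (right_primitive R <-> prime_ring R) /\ (prime_ring R <-> left_primitive R).
Proof.
have prime_simple : prime_ring R -> forall (I : {pred R}) (x : R),
    two_sided_ideal I -> x \in I -> x != 0 -> 1 \in I.
  move=> /prime_ring_converse hP I x /two_sided_ideal_converse.
  exact: (@prime_sigma_V_ring_simple R^c hR hP).
split; split=> hP.
- exact/prime_ring_converse/left_primitive_prime.
- apply: (@simple_ring_left_primitive R^c); first exact: hP.1.
  by move=> I x /two_sided_ideal_converse; exact: prime_simple.
- exact: (simple_ring_left_primitive hP.1 (prime_simple hP)).
- exact: left_primitive_prime.
Qed.
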